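(* Let $d\ge 2$, and let $a=(a_0,a_1,a_2,\ldots)$ be an eventually periodic binary sequence (with entries in $\mathbb F_2$). For each $h\ge 0$ let $\varepsilon_h$ be the depth-dependent labeling of the complete rooted $d$-ary tree $T_h^{(d)}$ induced by $a$. Then there exist integers $h_0\ge 0$ and $p\ge 1$ such that, for each residue class $r$ modulo $p$, there are rational constants $c_r,b_r$ satisfying \[ \operatorname{null} M(T_h^{(d)},\varepsilon_h)=c_r d^h+b_r \] for all $h\ge h_0$ with $h\equiv r\pmod p$.
   Context: All matrices and vector spaces are over the two-element field $\mathbb F_2$, and $\operatorname{null}(M)=\dim\ker(M)$. $T_h^{(d)}$ is the complete rooted $d$-ary tree of height $h$: every non-leaf vertex has exactly $d$ children and every root-to-leaf path has length $h$. The depth-dependent labeling $\varepsilon_h$ of $T_h^{(d)}$ associated with $a$ assigns label $a_j$ to every vertex whose descendant subtree has height $j$; thus leaves receive label $a_0$, their parents $a_1$, and the root $a_h$. For a tree $T$ with labeling $\varepsilon:V(T)\to\mathbb F_2$, $M(T,\varepsilon)=A(T)+D_\varepsilon$, where $A(T)$ is the adjacency matrix over $\mathbb F_2$ and $D_\varepsilon$ is the diagonal matrix with diagonal vector $\varepsilon$. *)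

(* Defs.v *)
From mathcomp Require Import all_boot all_order all_algebra.
Set Implicit Arguments.
Unset Strict Implicit.
Unset Printing Implicit Defensive.
Import GRing.Theory.
Local Open Scope ring_scope.

Definition adj_mx (V : finType) (e : rel V) : 'M['F_2]_#|V| :=
  \matrix_(i, j) (e (enum_val i) (enum_val j))%:R.

Definition label_mx (V : finType) (eps : V -> 'F_2) : 'M['F_2]_#|V| :=
  diag_mx (\row_i eps (enum_val i)).

Definition labeled_mx (V : finType) (e : rel V) (eps : V -> 'F_2) :
  'M['F_2]_#|V| := adj_mx e + label_mx eps.

(* The column space of [cokermx M] is the kernel [M *m x = 0]; [kermx] is the
   kernel of the action on row vectors. *)
Definition nullity (F : fieldType) (m n : nat) (M : 'M[F]_(m, n)) : nat :=
  \rank (cokermx M).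

(* A vertex is the word of length at most [h] over ['I_d] recording the child
   chosen at each step from the root [[::]]; leaves are the words of length
   [h], and the descendants of [u] are the words having [u] as a prefix. *)
Definition dtree (d h : nat) : finType := h.-bseq 'I_d.

Definition dtree_child (d h : nat) : rel (dtree d h) :=
  fun u v => [exists i : 'I_d, (v : seq 'I_d) == rcons u i].

Definition dtree_adj (d h : nat) : rel (dtree d h) :=
  fun u v => dtree_child u v || dtree_child v u.

Definition dtree_subheight (d h : nat) (u : dtree d h) : nat :=
  \max_(v : dtree d h | prefix u v) (size v - size u)%N.

Definition depth_labeling (a : nat -> 'F_2) (d h : nat) : dtree d h -> 'F_2 :=
  fun u => a (dtree_subheight u).

Definition eventually_periodic (T : Type) (a : nat -> T) : Prop :=
  exists N q : nat, (0 < q)%N /\ forall n, (N <= n)%N -> a (n + q)%N = a n.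

Lemma dtree_subheightE (d h : nat) (u : dtree d h) :
  (0 < d)%N -> dtree_subheight u = (h - size u)%N.
Proof.
move=> d_gt0; apply/eqP; rewrite eqn_leq; apply/andP; split.
  by apply/bigmax_leqP => v _; rewrite leq_sub2r ?size_bseq.
pose s := (u : seq 'I_d) ++ nseq (h - size u) (Ordinal d_gt0).
have sz_s : size s = h by rewrite size_cat size_nseq subnKC ?size_bseq.
have le_s : (size s <= h)%N by rewrite sz_s.
rewrite -[X in (X - _)%N]sz_s.
by rewrite (leq_bigmax_cond (Bseq le_s)) //= prefix_prefix.
Qed.

Lemma card_dtree_children (d h : nat) (u : dtree d h) :
  (size u < h)%N -> #|[set v | dtree_child u v]| = d.
Proof.
move=> lt_u.
have le_r i : (size (rcons u i) <= h)%N by rewrite size_rcons.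
pose f i : dtree d h := Bseq (le_r i).
have -> : [set v | dtree_child u v] = [set f i | i : 'I_d].
  apply/setP=> v; rewrite inE; apply/existsP/imsetP => [[i /eqP vE]|[i _ ->]].
    by exists i => //; apply/val_inj.
  by exists i.
rewrite card_imset ?card_ord // => i j /(congr1 val) /= /rcons_inj [].
by [].
Qed.

(* Main.v *)
(** Eliminating the tree from the leaves upwards replaces the subtree below each
    vertex of height [h] by a message depending only on [h]: either the vertex
    keeps an effective diagonal entry [c], or it has been used as the pivot of a
    singular child and its coordinate is forced to vanish.  Each message depends
    only on the previous one and on the label, so the messages are eventually
    periodic.  If the children carry the entry [0], one of them is matched with
    the parent and the other [d - 1] contribute to the kernel; hence the nullity
    solves [k (h + 1) = d * k h + t h] with [t] eventually periodic.  The
    elimination amounts to a count: the vectors that lie in the kernel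
    away from the root, with prescribed root coordinate and root residual, number
    a power of 2 or 0. *)
Require Import Defs.
From mathcomp Require Import all_boot all_order all_algebra.
From mathcomp Require Import mxabelem ring.
Set Implicit Arguments.
Unset Strict Implicit.
Unset Printing Implicit Defensive.
Import GRing.Theory Num.Theory.
Local Open Scope ring_scope.

(** * Counting kernel vectors as functions on the vertices *)

Lemma card_ker_labeled (V : finType) (e : rel V) (eps : V -> 'F_2) :
  #|[set x : {ffun V -> 'F_2} |
      [forall u, eps u * x u + \sum_(v | e v u) x v == 0]]|
    = (2 ^ nullity (labeled_mx e eps))%N.
Proof.
(* The matrix is square, so its row and column kernels have equal dimension; the row kernel is the
   one counted, whence [e v u] in the sum. *)
rewrite /nullity mxrank_coker -mxrank_ker.
transitivity (#|'F_2| ^ \rank (kermx (labeled_mx e eps)))%N; last first.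
  by rewrite card_Fp.
rewrite -card_rowg.
pose f (x : {ffun V -> 'F_2}) : 'rV_#|V| := \row_i x (enum_val i).
have f_inj : injective f.
  move=> x y /rowP fxy; apply/ffunP => u.
  by have := fxy (enum_rank u); rewrite !mxE enum_rankK.
rewrite -(card_imset _ f_inj); apply: eq_card => z.
have fK x u : (f x *m labeled_mx e eps) 0 (enum_rank u)
    = eps u * x u + \sum_(v | e v u) x v.
  rewrite mulmxDr !mxE addrC; congr (_ + _).
    rewrite (bigD1 (enum_rank u)) //= big1 => [|i /negPf iu].
      by rewrite !mxE eqxx enum_rankK addr0 mulrC.
    by rewrite !mxE iu mulr0n mulr0.
  rewrite (reindex _ (onW_bij _ (@enum_rank_bij V))) [RHS]big_mkcond /=.
  by apply: eq_bigr => v _; rewrite !mxE !enum_rankK; case: (e v u);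
     rewrite ?mulr1 ?mulr0.
rewrite [RHS]inE; apply/imsetP/idP => [[x]|/sub_kermxP zM].
  rewrite inE => /forallP xP ->; apply/sub_kermxP/rowP => i.
  by rewrite -(enum_valK i) fK (eqP (xP _)) mxE.
have Ez : z = f [ffun u => z 0 (enum_rank u)].
  by apply/rowP => i; rewrite !mxE ffunE enum_valK.
exists [ffun u => z 0 (enum_rank u)] => //.
by rewrite inE; apply/forallP => u; rewrite -fK -Ez zM mxE.
Qed.

(** * Eventually periodic sequences and recursions driven by them *)

Section EventualPeriods.

Variable T : Type.

Lemma periodicM (a : nat -> T) N q :
  (forall n, (N <= n)%N -> a (n + q)%N = a n) ->
  forall k n, (N <= n)%N -> a (n + k * q)%N = a n.
Proof.
move=> aP; elim=> [|k IH] n le_n; first by rewrite mul0n addn0.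
by rewrite mulSn addnA IH ?aP // (leq_trans le_n) ?leq_addr.
Qed.

Lemma periodic_eqmod (f : nat -> T) N p :
  (forall n, (N <= n)%N -> f (n + p)%N = f n) ->
  forall m n, (N <= m)%N -> (N <= n)%N -> m = n %[mod p] -> f m = f n.
Proof.
move=> fP m n; wlog le_mn : m n / (m <= n)%N => [hw|] le_m le_n eq_mn.
  by case/orP: (leq_total m n) => ?; [|symmetry]; apply: hw.
have /dvdnP [k kE] : (p %| n - m)%N by rewrite -eqn_mod_dvd // eq_mn.
by rewrite -(subnKC le_mn) kE (periodicM fP).
Qed.

End EventualPeriods.

(** Pigeonhole on the states sampled at the times [N + m * q]: two of them agree, and from there on
    both runs read the same inputs, so they agree forever. *)
Lemma eventually_periodic_state (T : Type) (S : finType)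
    (a : nat -> T) (F : T -> S -> S) (s : nat -> S) :
  (forall n, s n.+1 = F (a n.+1) (s n)) ->
  eventually_periodic a -> eventually_periodic s.
Proof.
move=> sS [N [q [q0 aP]]].
have /injectivePn [m1 [m2 neq12 eq12]] :
    ~~ injectiveb (fun m : 'I_#|S|.+1 => s (N + m * q)%N).
  by apply/injectiveP => /leq_card; rewrite card_ord ltnn.
wlog lt12 : m1 m2 neq12 eq12 / (m1 < m2)%N => [hw|].
  case: (ltngtP m1 m2) => [lt12|lt21|eqm]; first exact: hw lt12.
    by apply: hw lt21 => //; rewrite eq_sym.
  by case/eqP: neq12; apply: val_inj.
exists (N + m1 * q)%N, ((m2 - m1) * q)%N; split.
  by rewrite muln_gt0 subn_gt0 lt12.
move=> n /subnKC <-; elim: (n - _)%N => [|k IH].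
  by rewrite addn0 -addnA -mulnDl subnKC ?eq12 // ltnW.
rewrite addnS addSn !sS IH -addSn (periodicM aP) // ltnW // ltnS.
by rewrite -addnA leq_addr.
Qed.

(** Removing one multiple of [d ^ n] leaves a periodic sequence, so a single [c] serves all residue
    classes. The bounds on [d] and [p] make [D ^+ p - 1] invertible. *)
Lemma periodic_forcing (d : nat) (hd : (2 <= d)%N) (k t : nat -> nat) N p :
  (0 < p)%N ->
  (forall n, k n.+1 = d * k n + t n)%N ->
  (forall n, (N <= n)%N -> t (n + p)%N = t n) ->
  exists c : rat, forall n, (N <= n)%N ->
    (k (n + p)%N)%:R - c * d%:R ^+ (n + p)
      = (k n)%:R - c * d%:R ^+ n.
Proof.
move=> p0 kS tP; set D : rat := d%:R.
have D0 : D != 0 by rewrite pnatr_eq0 -lt0n ltnW.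
have Dp : D ^+ p - 1 != 0.
  by rewrite subr_eq0 -natrX pnatr_eq1 -(expn0 d) eqn_exp2l // -lt0n.
(* [k (n + p) - k n] is geometric of ratio [d]; match it with the increment
   [c * d ^ n * (d ^ p - 1)] of [c * d ^ n]. *)
pose e n : rat := (k (n + p)%N)%:R - (k n)%:R.
have eE m : e (N + m)%N = D ^+ m * e N.
  elim: m => [|m IH]; first by rewrite addn0 expr0 mul1r.
  rewrite addnS exprS -mulrA -IH /e addSn !kS tP ?leq_addr // !natrD !natrM.
  by rewrite -/D; ring.
exists (e N / D ^+ N / (D ^+ p - 1)) => n /subnKC <-.
apply/eqP; rewrite -subr_eq0; apply/eqP.
have := eE (n - N)%N; rewrite /e => /(canRL (subrK _)) ->.
rewrite !exprD; field.
by rewrite Dp expf_neq0.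
Qed.

(** * A tree of height [h.+1] as a root joined to [d] trees of height [h] *)

Section TreeRecursion.

Variables d h : nat.

Definition dtree_root n : dtree d n := nil_bseq n 'I_d.

Definition dtree_cons (i : 'I_d) (u : dtree d h) : dtree d h.+1 :=
  cons_bseq i u.

Lemma dtree_cons_inj i j u v :
  dtree_cons i u = dtree_cons j v -> i = j /\ u = v.
Proof. by move/(congr1 val) => -[-> uv]; split=> //; apply: val_inj. Qed.

Variant dtree_spec : dtree d h.+1 -> Type :=
  | DtreeRoot : dtree_spec (dtree_root h.+1)
  | DtreeCons i u : dtree_spec (dtree_cons i u).

Lemma dtreeP u : dtree_spec u.
Proof.
case: u => -[|i s] us.
  by rewrite (_ : Bseq us = dtree_root _); [constructor | apply: val_inj].
rewrite (_ : Bseq us = dtree_cons i (Bseq (us : size s <= h)%N)).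
  by constructor.
exact: val_inj.
Qed.

Lemma dtree_child_cons i u j v :
  dtree_child (dtree_cons i u) (dtree_cons j v) = (i == j) && dtree_child u v.
Proof.
apply/existsP/andP => [[k]|[/eqP -> /existsP [k uv]]].
  rewrite /= eqseq_cons eq_sym => /andP [ij uv].
  by split=> //; apply/existsP; exists k.
by exists k; rewrite /= eqseq_cons eqxx.
Qed.

Lemma dtree_adj_cons i u j v :
  dtree_adj (dtree_cons i u) (dtree_cons j v) = (i == j) && dtree_adj u v.
Proof. by rewrite /dtree_adj !dtree_child_cons (eq_sym j) andb_orr. Qed.

Lemma dtree_adj_root_cons j (v : dtree d h) :
  dtree_adj (dtree_root h.+1) (dtree_cons j v) = (v == dtree_root h).
Proof.
rewrite /dtree_adj /dtree_child orbC; case: existsP => [[]//|_] /=.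
apply/existsP/eqP => [[k /eqP [_ v0]]|->]; first exact: val_inj.
by exists j.
Qed.

Lemma dtree_adj_root0 n : dtree_adj (dtree_root n) (dtree_root n) = false.
Proof. by rewrite /dtree_adj orbb; apply/existsP => -[]. Qed.

Lemma dtree_adj_sym n : symmetric (@dtree_adj d n).
Proof. by move=> u v; rewrite /dtree_adj orbC. Qed.

Lemma big_dtree (F : dtree d h.+1 -> 'F_2) (P : pred (dtree d h.+1)) :
  \sum_(u | P u) F u = (if P (dtree_root _) then F (dtree_root _) else 0)
    + \sum_i \sum_(u | P (dtree_cons i u)) F (dtree_cons i u).
Proof.
rewrite big_mkcond (bigD1 (dtree_root h.+1)) //=; congr (_ + _).
under [RHS]eq_bigr do rewrite big_mkcond.
rewrite pair_big /=.
pose f (p : 'I_d * dtree d h) := dtree_cons p.1 p.2.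
have f_inj : {in predT &, injective f}.
  by move=> [i u] [j v] _ _ /dtree_cons_inj [/= -> ->].
rewrite -(big_imset (fun u => if P u then F u else 0) f_inj).
apply: eq_bigl => u; case: u / dtreeP => [|i u].
  by rewrite eqxx; symmetry; apply/imsetP => -[].
by rewrite (imset_f f (_ : (i, u) \in _)).
Qed.

End TreeRecursion.

(** * Kernel equations on the tree, and gluing solutions on the subtrees *)

Section Residual.

Variables (d : nat) (a : nat -> 'F_2).

(** Coordinate [u] of the labeled matrix applied to [x], with the subtree height written as in
    [dtree_subheightE]. *)
Definition residual h (x : dtree d h -> 'F_2) (u : dtree d h) : 'F_2 :=
  a (h - size u)%N * x u + \sum_(v | dtree_adj u v) x v.

Lemma residual_root h (x : dtree d h.+1 -> 'F_2) :
  residual x (dtree_root d h.+1) = a h.+1 * x (dtree_root d h.+1)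
    + \sum_i x (dtree_cons i (dtree_root d h)).
Proof.
rewrite /residual big_dtree dtree_adj_root0 add0r; congr (_ + _).
by apply: eq_bigr => i _; under eq_bigl do rewrite dtree_adj_root_cons;
  rewrite big_pred1_eq.
Qed.

Lemma residual_cons h (x : dtree d h.+1 -> 'F_2) i (u : dtree d h) :
  residual x (dtree_cons i u) = residual (fun v => x (dtree_cons i v)) u
    + (if u == dtree_root d h then x (dtree_root d h.+1) else 0).
Proof.
rewrite /residual big_dtree dtree_adj_sym dtree_adj_root_cons addrCA [LHS]addrC.
congr (_ + _ + _); rewrite (bigD1 i) //= [X in _ + X]big1 => [|j ji].
  by rewrite addr0; apply: eq_bigl => v; rewrite dtree_adj_cons eqxx.
by apply: big_pred0 => v; rewrite dtree_adj_cons eq_sym (negPf ji).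
Qed.

Definition dtree_sols h (v w : 'F_2) : {set {ffun dtree d h -> 'F_2}} :=
  [set x : {ffun dtree d h -> 'F_2} | (x (dtree_root d h) == v)
    && [forall u, residual x u == if u == dtree_root d h then w else 0]].

(** The tail [s] has length at most [h], so [insubd] returns it as a vertex of the subtree. *)
Definition dtree_glue h (v : 'F_2) (f : {ffun 'I_d -> {ffun dtree d h -> 'F_2}})
    : {ffun dtree d h.+1 -> 'F_2} :=
  [ffun u => if val u is i :: s then f i (insubd (dtree_root d h) s) else v].

Lemma dtree_glue_root h v f : dtree_glue (h := h) v f (dtree_root d h.+1) = v.
Proof. by rewrite ffunE. Qed.

Lemma dtree_glue_cons h v f i u :
  dtree_glue (h := h) v f (dtree_cons i u) = f i u.
Proof. by rewrite ffunE /= valKd. Qed.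

Lemma residual_glue_root h v f :
  residual (dtree_glue (h := h) v f) (dtree_root d h.+1)
    = a h.+1 * v + \sum_i [ffun i => f i (dtree_root d h)] i.
Proof.
rewrite residual_root dtree_glue_root; congr (_ + _).
by apply: eq_bigr => i _; rewrite dtree_glue_cons ffunE.
Qed.

Lemma residual_glue_cons h v f i u :
  residual (dtree_glue (h := h) v f) (dtree_cons i u)
    = residual (f i) u + (if u == dtree_root d h then v else 0).
Proof.
rewrite residual_cons dtree_glue_root /residual dtree_glue_cons.
by congr (_ + _ + _); apply: eq_bigr => t _; rewrite dtree_glue_cons.
Qed.

(** A solution is a root value glued to [d] vectors on the subtrees. The root adds [v] to the
    residual at each child, so each subtree must have root residual [- v = v]. Once the coordinates
    [g] of the children are fixed, the subtrees are chosen independently. *)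
Lemma card_dtree_solsS h v w :
  #|dtree_sols h.+1 v w| =
    (\sum_(g : {ffun 'I_d -> 'F_2} | (a h.+1 * v + \sum_i g i == w)%R)
       \prod_i #|dtree_sols h (g i) v|)%N.
Proof.
pose rt (f : {ffun 'I_d -> {ffun dtree d h -> 'F_2}}) : {ffun 'I_d -> 'F_2} :=
  [ffun i => f i (dtree_root d h)].
pose A := [set f : {ffun 'I_d -> {ffun dtree d h -> 'F_2}} |
  (a h.+1 * v + \sum_i rt f i == w) && [forall i, f i \in dtree_sols h (rt f i) v]].
have glue_inj : injective (@dtree_glue h v).
  move=> f g fg; apply/ffunP => i; apply/ffunP => u.
  by rewrite -!(dtree_glue_cons v) fg.
have glueP f : (dtree_glue v f \in dtree_sols h.+1 v w) = (f \in A).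
  rewrite !inE dtree_glue_root eqxx /=; apply/forallP/andP => [fP|[f0 fP] u].
    split.
      by have := fP (dtree_root d h.+1); rewrite residual_glue_root eqxx.
    apply/forallP => i; rewrite inE ffunE eqxx /=; apply/forallP => u.
    have := fP (dtree_cons i u).
    by rewrite residual_glue_cons addr_eq0 oppr_pchar2 ?pchar_Fp.
  case: u / dtreeP => [|i u]; first by rewrite residual_glue_root eqxx.
  rewrite residual_glue_cons addr_eq0 oppr_pchar2 ?pchar_Fp //.
  by have := forallP fP i; rewrite inE => /andP [_ /forallP].
have -> : dtree_sols h.+1 v w = @dtree_glue h v @: A.
  apply/setP => x; apply/idP/imsetP => [xP|[f fA ->]]; last by rewrite glueP.
  have xE : x = dtree_glue v [ffun i => [ffun u => x (dtree_cons i u)]].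
    apply/ffunP => u; case: u / dtreeP => [|i u].
      by rewrite dtree_glue_root; move: xP; rewrite inE => /andP [/eqP].
    by rewrite dtree_glue_cons !ffunE.
  by rewrite xE; eexists; last reflexivity; rewrite -glueP -xE.
rewrite card_imset // -sum1_card.
rewrite (partition_big rt (fun g => a h.+1 * v + \sum_i g i == w)) => [|f];
  last by rewrite inE => /andP [].
apply: eq_bigr => g /eqP gw; rewrite sum1_card.
transitivity #|family (fun i => mem (dtree_sols h (g i) v))|; last first.
  by rewrite card_family foldrE big_map big_enum.
apply: eq_card => f; rewrite [LHS]inE [f \in A]inE.
apply/andP/familyP => [[/andP [_ /forallP fP] /eqP <-] i|fP]; first exact: fP.
have fg : rt f = g.
  by apply/ffunP => i; have := fP i; rewrite !inE ffunE => /andP [/eqP].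
by rewrite fg gw !eqxx; split=> //; apply/forallP => i; exact: fP.
Qed.

End Residual.

(** * Messages, and the number of solutions they allow *)

Section Counting.

Variables (d : nat) (a : nat -> 'F_2).
Hypothesis d_gt0 : (0 < d)%N.

(* [Some b] is the effective diagonal entry of the children, [None] says that
   their coordinates are forced to vanish.  Minus signs are invisible in
   characteristic 2. *)
Definition message_next (c : 'F_2) (s : option 'F_2) : option 'F_2 :=
  if s is Some b then if b == 0 then None else Some (c + d%:R) else Some c.

Fixpoint message h : option 'F_2 :=
  if h is h'.+1 then message_next (a h) (message h') else Some (a 0%N).

(* Possible pairs of a root coordinate [v] and a root residual [w]. *)
Definition message_rel (s : option 'F_2) (v w : 'F_2) : bool :=
  if s is Some c then w == c * v else v == 0.

(* The nullity without the contribution of a root whose effective diagonal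
   entry is [0]. *)
Fixpoint interior_nullity h : nat :=
  if h is h'.+1
  then (d * interior_nullity h' + d.-1 * (message h' == Some 0%R))%N else 0.

Lemma F2_cases (c : 'F_2) : c = 0 \/ c = 1.
Proof. by case: c => -[|[|//]] ?; [left|right]; apply: val_inj. Qed.

(* Adding the indicator of [i0] exchanges the two values of the sum. *)
Lemma card_ffun_sum (w : 'F_2) :
  #|[set g : {ffun 'I_d -> 'F_2} | \sum_i g i == w]| = (2 ^ d.-1)%N.
Proof.
pose i0 := Ordinal d_gt0.
pose e : {ffun 'I_d -> 'F_2} := [ffun i => (i == i0)%:R].
have sum_e : \sum_i e i = 1.
  rewrite (bigD1 i0) //= big1 => [|i /negPf ii0]; last by rewrite ffunE ii0.
  by rewrite ffunE eqxx addr0.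
pose S w := [set g : {ffun 'I_d -> 'F_2} | \sum_i g i == w].
have S10 : #|S 1| = #|S 0|.
  rewrite -(card_imset (S 0) (addrI e)); apply: eq_card => g.
  apply/idP/imsetP => [|[f + ->]]; rewrite !inE => /eqP gP.
    exists (g - e); last by rewrite addrC subrK.
    have -> : g - e = [ffun i => g i - e i].
      by apply/ffunP => i; rewrite !ffunE.
    rewrite inE; under eq_bigr do rewrite ffunE.
    by rewrite sumrB gP sum_e subrr.
  by under eq_bigr do rewrite ffunE; rewrite big_split /= gP sum_e addr0.
have : (#|S 0%R| + #|S 1%R| = 2 ^ d)%N.
  rewrite -[RHS](_ : #|{ffun 'I_d -> 'F_2}| = _)%N; last first.
    by rewrite card_ffun card_Fp // card_ord.
  rewrite -(cardC (S 0)); congr (_ + _)%N; apply: eq_card => g.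
  by rewrite !inE; case: (F2_cases (\sum_i g i)) => ->.
have -> : (2 ^ d = (2 ^ d.-1).*2)%N by rewrite -mul2n -expnS prednK.
rewrite S10 addnn => /double_inj <-; rewrite -/(S w).
by case: (F2_cases w) => ->.
Qed.

(** Entry 0 at the children forces [v = 0] and leaves their coordinates free up to one linear
    condition, hence [d.-1] dimensions. In the other cases these coordinates are determined and only
    the root equation remains. *)
Lemma card_message_next (s : option 'F_2) (c v w : 'F_2) :
  #|[set g : {ffun 'I_d -> 'F_2} | (c * v + \sum_i g i == w)
      && [forall i, message_rel s (g i) v]]|
    = (message_rel (message_next c s) v w
         * 2 ^ (d.-1 * (s == Some 0%R)))%N.
Proof.
pose i0 := Ordinal d_gt0.
(* The forced coordinate [b] is [v] for children with entry 1, and 0 for [None]. *)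
have card_const b : (forall g, message_rel s g v = (g == b)) ->
    #|[set g : {ffun 'I_d -> 'F_2} | (c * v + \sum_i g i == w)
      && [forall i, message_rel s (g i) v]]| = (c * v + b *+ d == w).
  move=> sb; transitivity
      #|[set g : {ffun 'I_d -> 'F_2} | (c * v + b *+ d == w)
        && (g == [ffun=> b])]|.
    apply: eq_card => g; rewrite !inE.
    have -> : [forall i, message_rel s (g i) v] = (g == [ffun=> b]).
      apply/forallP/eqP => [gb|-> i]; last by rewrite sb ffunE.
      by apply/ffunP => i; have := gb i; rewrite sb ffunE => /eqP.
    have [->|_] := eqVneq g; last by rewrite !andbF.
    rewrite !andbT; under eq_bigr do rewrite ffunE.
    by rewrite sumr_const card_ord.
  case: (_ == w) => /=; last by apply: eq_card0 => g; rewrite inE.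
  rewrite -[RHS](cards1 ([ffun=> b] : {ffun 'I_d -> 'F_2})).
  by apply: eq_card => g; rewrite !inE.
case: s card_const => [b|] card_const /=.
  case: (F2_cases b) card_const => -> card_const.
    rewrite !eqxx muln1 /=.
    have [->|v0] := eqVneq v 0.
      rewrite mul1n -(card_ffun_sum w); apply: eq_card => g; rewrite !inE.
      rewrite mulr0 add0r (_ : [forall i, _]) ?andbT //.
      by apply/forallP => i; rewrite mul0r.
    rewrite mul0n; apply: eq_card0 => g; rewrite !inE.
    apply/negP => /andP [_ /forallP /(_ i0)].
    by rewrite mul0r (negPf v0).
  rewrite (card_const v) => [|g]; last by rewrite /= mul1r eq_sym.
  rewrite /= muln0 expn0 muln1 eq_sym mulrDl.
  by rewrite mulr_natl.
rewrite (card_const 0) // mul0rn addr0 muln0 muln1 eq_sym //.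
Qed.

Lemma card_dtree_sols h v w :
  #|dtree_sols d a h v w|
    = (message_rel (message h) v w * 2 ^ interior_nullity h)%N.
Proof.
elim: h v w => [|h IH] v w.
  have rootE u : u = dtree_root d 0 by apply: val_inj; case: u => -[].
  have resE (x : {ffun dtree d 0 -> 'F_2}) :
      residual a x (dtree_root d 0) = a 0%N * x (dtree_root d 0).
    rewrite /residual big_pred0 ?addr0 // => u.
    by rewrite (rootE u) dtree_adj_root0.
  transitivity #|[set x : {ffun dtree d 0 -> 'F_2} |
      (w == a 0%N * v) && (x == [ffun=> v])]|.
    apply: eq_card => x; rewrite !inE andbC.
    have -> : (x == [ffun=> v]) = (x (dtree_root d 0) == v).
      apply/eqP/eqP => [->|xv]; first by rewrite ffunE.
      by apply/ffunP => u; rewrite (rootE u) ffunE.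
    case: eqP => [xv|_]; rewrite ?andbF // !andbT.
    apply/forallP/eqP => [/(_ (dtree_root d 0))|-> u].
      by rewrite resE xv eqxx => /eqP.
    by rewrite (rootE u) resE xv !eqxx.
  rewrite expn0 muln1 /=; case: (w == _) => /=.
    rewrite -[RHS](cards1 ([ffun=> v] : {ffun dtree d 0 -> 'F_2})).
    by apply: eq_card => x; rewrite !inE.
  by apply: eq_card0 => x; rewrite inE.
rewrite card_dtree_solsS.
under eq_bigr do under eq_bigr do rewrite IH.
under eq_bigr do rewrite big_split /= prod_nat_const card_ord -expnM.
rewrite -big_distrl /= expnD mulnA mulnAC (mulnC d) -card_message_next.
(* A product of indicators is the indicator of the conjunction, so the sum over [g] is the cardinal
   in [card_message_next]. *)
congr (_ * _)%N; rewrite -sum1_card big_mkcond [RHS]big_mkcond /=.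
apply: eq_bigr => g _; rewrite inE; case: (_ == w) => //=.
case: forallP => [gP|/forallP]; first by rewrite big1 // => i _; rewrite gP.
rewrite negb_forall => /existsP [i /negPf gi].
by rewrite (bigD1 i) //= gi.
Qed.

(** The kernel splits by root coordinate, with root residual 0. The value 0 is always allowed, and 1
    only when the message is [Some 0], which doubles the count. *)
Lemma nullity_dtree h :
  nullity (labeled_mx (@dtree_adj d h) (@depth_labeling a d h))
    = (interior_nullity h + (message h == Some 0%R))%N.
Proof.
apply/eqP; rewrite -(eqn_exp2l _ _ (isT : 1 < 2)%N) -card_ker_labeled.
apply/eqP; transitivity (\sum_(v : 'F_2) #|dtree_sols d a h v 0%R|)%N.
  rewrite -sum1_card.
  rewrite (partition_big (fun x : {ffun _} => x (dtree_root d h)) predT) //=.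
  apply: eq_bigr => v _; rewrite sum1_card; apply: eq_card => x.
  rewrite !inE [LHS]inE inE andbC; congr (_ && _).
  apply: eq_forallb => u; rewrite /depth_labeling dtree_subheightE //.
  by rewrite if_same; under eq_bigl do rewrite dtree_adj_sym.
under eq_bigr do rewrite card_dtree_sols; rewrite -big_distrl /= mulnC expnD.
congr (_ * _)%N; rewrite !big_ord_recl big_ord0.
case: (message h) => [c|]; last by [].
by case: (F2_cases c) => ->.
Qed.

End Counting.

(** * The nullity along residue classes *)

Theorem theorem1p5 (d : nat) (hd : (2 <= d)%N) (a : nat -> 'F_2)
    (ha : eventually_periodic a) :
  exists h0 p : nat, (1 <= p)%N /\
    forall r : nat, (r < p)%N ->
      exists c b : rat, forall h : nat,
        (h0 <= h)%N -> (h = r %[mod p])%N ->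
        (nullity (labeled_mx (@dtree_adj d h) (@depth_labeling a d h)))%:R
          = c * d%:R ^+ h + b.
Proof.
have d0 : (0 < d)%N by rewrite ltnW.
have [h0 [p [p0 sP]]] :=
  eventually_periodic_state (fun n => erefl : message d a n.+1 = _) ha.
exists h0, p; split=> // r _.
pose k := interior_nullity d a.
have [c cP] : exists c : rat, forall n, (h0 <= n)%N ->
    (k (n + p)%N)%:R - c * d%:R ^+ (n + p) = (k n)%:R - c * d%:R ^+ n.
  pose t n := (d.-1 * (message d a n == Some 0%R))%N.
  by apply: (periodic_forcing hd (t := t) p0) => // n le_n; rewrite /t sP.
(* [f] is the nullity minus [c * d ^ n], which has period [p] from [h0] on. Its value on the class
   of [r] is read off at [r + h0 * p], which is at least [h0] since [p] is positive. *)
pose f n : rat := (k n)%:R - c * d%:R ^+ n + (message d a n == Some 0%R)%:R.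
exists c, (f (r + h0 * p)%N) => h le_h hr.
rewrite nullity_dtree // natrD -(@periodic_eqmod _ f h0 p _ h) //.
- by rewrite /f -/k; ring.
- by move=> n le_n; rewrite /f cP // sP.
- by rewrite (leq_trans (leq_pmulr h0 p0)) ?leq_addl.
- by rewrite addnC modnMDl.
Qed.
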